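(* Let $\mathsf H$ be a real Hilbert space with norm $|\cdot|$. For every $i\in\{1,\ldots,m\}$, let $\mathsf A_i\colon\mathsf H\to2^{\mathsf H}$ be maximally monotone; let $\beta\in\,]0,+\infty[$ and let $\mathsf B\colon\mathsf H\to\mathsf H$ be $\beta$-cocoercive. Suppose that there exists $\mathsf x\in\mathsf H$ such that $\mathsf 0\in\sum_{i=1}^m\mathsf A_i\mathsf x+\mathsf B\mathsf x$. Let $(\omega_i)_{1\le i\le m}$ be real numbers in $]0,1[$ such that $\sum_{i=1}^m\omega_i=1$. Let $\gamma\in\,]0,2\beta[$, let $\alpha=\max\{2/3,\,2\gamma/(\gamma+2\beta)\}$, let $(\lambda_n)_{n\in\mathbb N}$ be a sequence in $]0,1/\alpha[$, let $(\mathsf a_n)_{n\in\mathbb N}$ and, for every $i\in\{1,\ldots,m\}$, $(\mathsf b_{i,n})_{n\in\mathbb N}$ be sequences in $\mathsf H$, and suppose that $$\sum_{n\in\mathbb N}\lambda_n(1-\alpha\lambda_n)=+\infty\quad\text{and}\quad\max_{1\le i\le m}\sum_{n\in\mathbb N}\lambda_n\big(|\mathsf a_n|+|\mathsf b_{i,n}|\big)<+\infty.$$ Let $(\mathsf z_{i,0})_{1\le i\le m}\in\mathsf H^m$ and, for every $n\in\mathbb N$, set $\mathsf x_n=\sum_{i=1}^m\omega_i\mathsf z_{i,n}$ and, for $i=1,\ldots,m$, $$\begin{aligned}\mathsf s_{i,n}&=2\mathsf x_n-\mathsf z_{i,n}-\gamma(\mathsf B\mathsf x_n+\mathsf a_n),\\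 \mathsf p_{i,n}&=J_{\gamma\mathsf A_i/\omega_i}\mathsf s_{i,n}+\mathsf b_{i,n},\\ \mathsf z_{i,n+1}&=\mathsf z_{i,n}+\lambda_n(\mathsf p_{i,n}-\mathsf x_n).\end{aligned}$$ Then there exists $\overline{\mathsf x}\in\mathsf H$ with $\mathsf 0\in\sum_{i=1}^m\mathsf A_i\overline{\mathsf x}+\mathsf B\overline{\mathsf x}$ such that the following hold. (i) $\mathsf x_n\rightharpoonup\overline{\mathsf x}$. (ii) $\mathsf B\mathsf x_n\to\mathsf B\overline{\mathsf x}$. (iii) $\mathsf x_{n+1}-\mathsf x_n\to0$.
   Context: $\mathsf B$ is $\beta$-cocoercive means: for all $\mathsf x,\mathsf y\in\mathsf H$, $\langle\mathsf x-\mathsf y\mid\mathsf B\mathsf x-\mathsf B\mathsf y\rangle\ge\beta|\mathsf B\mathsf x-\mathsf B\mathsf y|^2$. For a maximally monotone operator $M$, $J_M=(\mathrm{Id}+M)^{-1}$ is its (single-valued, everywhere defined) resolvent. $\rightharpoonup$ and $\to$ denote weak and strong convergence, respectively. *)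

(* Defs.v *)
From HB Require Import structures.
From mathcomp Require Import all_boot all_order all_algebra.
From mathcomp Require Import all_classical all_reals all_analysis.

Set Implicit Arguments.
Unset Strict Implicit.
Unset Printing Implicit Defensive.

Import Order.TTheory GRing.Theory Num.Theory.
Import numFieldNormedType.Exports.

Local Open Scope classical_set_scope.
Local Open Scope ring_scope.

Section Operators.
Context {R : realType} {H : completeNormedModType R}.
Implicit Types (M : H -> set H) (x u : H).

(* The graph of an operator M : H -> 2^H is {(x, u) | M x u}. *)

Definition op_scale (c : R) M : H -> set H := fun x => [set c *: u | u in M x].

Definition op_sum (m : nat) (A : 'I_m -> H -> set H) : H -> set H :=
  fun x => [set \sum_(i < m) u i | u in [set u | forall i, A i x (u i)]].

Definition op_add_fun M (f : H -> H) : H -> set H :=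
  fun x => [set u + f x | u in M x].

Definition op_inv M : H -> set H := fun u => [set x | M x u].

(* (Id + M)^-1 is a set-valued operator; [get] picks its value at u, which
   is unique and exists for all u when M is maximally monotone (Minty), and is
   an arbitrary point when the set is empty. *)
Definition resolvent M : H -> H :=
  fun u => get (op_inv (op_add_fun M id) u).

(* A real Hilbert space is a complete normed module H whose norm comes from a
   positive definite symmetric bilinear form: forall x, `|x| = sqrt (dot x x).
   That norm equation is not part of {dot H for idfun}, which only knows the
   linear structure of H, so it must be assumed alongside dot. *)
Section InnerProduct.
Variable dot : {dot H for idfun}.

Definition monotone M : Prop :=
  forall x y u v, M x u -> M y v -> 0 <= dot (x - y) (u - v).

Definition maximally_monotone M : Prop :=
  monotone M /\
  forall N : H -> set H, monotone N -> (forall x, M x `<=` N x) -> N = M.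

Definition cocoercive (beta : R) (B : H -> H) : Prop :=
  forall x y, beta * `|B x - B y| ^+ 2 <= dot (x - y) (B x - B y).

(* By the Riesz representation theorem the continuous linear functionals of a
   Hilbert space are exactly the maps dot ^~ u. *)
Definition weakly_cvg (x : nat -> H) (l : H) : Prop :=
  forall u, dot (x n) u @[n --> \oo] --> dot l u.

End InnerProduct.
End Operators.

(* Main.v *)
Require Import Defs.
From HB Require Import structures.
From mathcomp Require Import all_boot all_order all_algebra.
From mathcomp Require Import all_classical all_reals all_analysis.
From mathcomp Require Import ring lra.

Set Implicit Arguments.
Unset Strict Implicit.
Unset Printing Implicit Defensive.

Import Order.TTheory GRing.Theory Num.Theory.
Import numFieldNormedType.Exports.

Local Open Scope classical_set_scope.
Local Open Scope ring_scope.

(** The iteration is an inexact relaxed fixed point iteration in the product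
    space H^m with inner product (z, z') |-> sum_i omega_i <z_i, z'_i>. Write
    P z = sum_i omega_i z_i for the barycenter, which is the orthogonal
    projection of H^m onto its diagonal, and
      (Q z)_i = J_(gamma A_i / omega_i) (2 P z - z_i - gamma B (P z)).
    Up to errors of size lambda_n (gamma |a_n| + |b_(i,n)|), the algorithm is
    z_(n+1) = z_n + lambda_n (Q z_n - P z_n). Put
      T z = z + (Q z - P z) / alpha   and   mu_n = alpha lambda_n;
    then z_(n+1) = z_n + mu_n (T z_n - z_n) + summable error, 0 < mu_n < 1, and
    sum_n mu_n (1 - mu_n) = +oo.

    Three facts give the result. First, z is a fixed point of T if and only if
    Q z = P z, and then P z is a zero of sum_i A_i + B; conversely each zero
    lifts to a fixed point ([zero_splitting_fix], [splitting_fix_zero]).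
    Second, the resolvents are firmly nonexpansive and B composed with P is
    cocoercive, so that the displacement d = z - z' and the increments
    D = (Q z - P z) - (Q z' - P z') and b = B (P z) - B (P z') satisfy
      |d + D|^2 + |D + gamma b|^2 + gamma (2 beta - gamma) |b|^2 <= |d|^2
    ([three_operator_estimate]). Bounding |D|^2 by the last two terms on the
    left shows that T is nonexpansive for the given alpha
    ([three_operator_averaged], [averagedness_constant]).
    Third, the Krasnoselskii-Mann iteration of a nonexpansive map with summable
    errors has residual tending to 0 and converges weakly to a fixed point c
    ([KM_residual_cvg0], [KM_weak_cvg]).

    Weak convergence of x_n = P z_n to P c follows. Applying the estimate to z_n
    and c, where D tends to 0 and d stays bounded, forces B x_n - B (P c) to
    tend to 0. Finally |x_(n+1) - x_n| is at most the residual plus the error.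

    Two classical theorems are proved on the way: Minty's theorem, which makes
    the resolvents everywhere defined, and the weak compactness of bounded
    sequences, in the form that they converge weakly along every ultrafilter.
    Both rest on one variational principle, the minimization of
    t + |w|^2 / 2 over a closed convex epigraph ([convex_epigraph_min]):
    Riesz's theorem minimizes |w|^2 / 2 - phi w, and Minty's theorem minimizes
    F + |.|^2 / 2 for the Fitzpatrick function F of the operator. *)

(** * Inner products *)

Lemma subrACA (V : zmodType) (x y z t : V) :
  x - y - (z - t) = x - z - (y - t).
Proof. by rewrite !opprB addrACA [RHS]addrACA [- z - _]addrC. Qed.

Lemma normr_le_cvg0 (R : realType) (V : normedModType R) (F : set_system nat)
    (f : nat -> V) (g : nat -> R) {FF : ProperFilter F} :
  (forall n, `|f n| <= g n) -> g @ F --> 0 -> f @ F --> 0.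
Proof.
move=> fg g0; apply/norm_cvg0P.
apply: (@squeeze_cvgr _ _ _ _ (cst 0) g) => //; last exact: cvg_cst.
by apply: nearW => n; rewrite normr_ge0 fg.
Qed.

Section DotTheory.
Context {R : realType} {V : lmodType R} (dot : {dot V for idfun}).
Implicit Types (x y z : V) (c : R).

Lemma dotC x y : dot x y = dot y x.
Proof. by rewrite [LHS]hermitian_subproof expr0 mul1r. Qed.

Lemma dotDl x y z : dot (x + y) z = dot x z + dot y z.
Proof. exact: linearDl. Qed.

Lemma dotDr x y z : dot z (x + y) = dot z x + dot z y.
Proof. exact: linearDr. Qed.

Lemma dotNl x y : dot (- x) y = - dot x y.
Proof. by rewrite -scaleN1r linearZl_LR mulN1r. Qed.

Lemma dotNr x y : dot y (- x) = - dot y x.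
Proof. exact: linearNr. Qed.

Lemma dotZl c x y : dot (c *: x) y = c * dot x y.
Proof. exact: linearZl_LR. Qed.

Lemma dotZr c x y : dot y (c *: x) = c * dot y x.
Proof. exact: linearZr_LR. Qed.

Lemma dot0l x : dot 0 x = 0.
Proof. exact: linear0l. Qed.

Lemma dot0r x : dot x 0 = 0.
Proof. exact: linear0r. Qed.

Definition dotE := (dotDl, dotDr, dotNl, dotNr, dotZl, dotZr, dot0l, dot0r).

Lemma dot_gt0 x : x != 0 -> 0 < dot x x.
Proof. exact: neq0_dnorm_gt0. Qed.

Lemma dot_ge0 x : 0 <= dot x x.
Proof.
by have [->|/dot_gt0/ltW//] := eqVneq x 0; rewrite dot0l.
Qed.

Lemma dot_le0 x : dot x x <= 0 -> x = 0.
Proof.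
by move=> xx; apply/eqP; apply: contraTT xx => /dot_gt0; rewrite -ltNge.
Qed.

Definition hnorm x : R := Num.sqrt (dot x x).

Lemma hnorm_sqr x : hnorm x ^+ 2 = dot x x.
Proof. by rewrite sqr_sqrtr// dot_ge0. Qed.

Lemma hnorm_ge0 x : 0 <= hnorm x.
Proof. exact: sqrtr_ge0. Qed.

Lemma hnormN x : hnorm (- x) = hnorm x.
Proof. by rewrite /hnorm dotNl dotNr opprK. Qed.

Lemma hnorm0 : hnorm 0 = 0.
Proof. by rewrite /hnorm dot0l sqrtr0. Qed.

Lemma hnormZ c x : hnorm (c *: x) = `|c| * hnorm x.
Proof. by rewrite /hnorm dotZl dotZr mulrA -expr2 sqrtrM ?sqr_ge0// sqrtr_sqr. Qed.

Lemma hnorm_le x c : 0 <= c -> dot x x <= c ^+ 2 -> hnorm x <= c.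
Proof. by move=> c0; rewrite -hnorm_sqr ler_pXn2r ?nnegrE ?hnorm_ge0. Qed.

Lemma dot_hnorm_le x y : dot x y <= hnorm x * hnorm y.
Proof.
have [->|x0] := eqVneq x 0; first by rewrite dot0l hnorm0 mul0r.
have [->|y0] := eqVneq y 0; first by rewrite dot0r hnorm0 mulr0.
have xnrm : 0 < hnorm x by rewrite sqrtr_gt0 dot_gt0.
have ynrm : 0 < hnorm y by rewrite sqrtr_gt0 dot_gt0.
have := dot_ge0 (hnorm y *: x - hnorm x *: y).
rewrite !dotE -!hnorm_sqr (dotC y x).
move=> h; have : 0 <= (hnorm x * hnorm y) * (hnorm x * hnorm y - dot x y) by lra.
by rewrite pmulr_rge0 ?mulr_gt0// subr_ge0.
Qed.

Lemma normr_dot_le x y : `|dot x y| <= hnorm x * hnorm y.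
Proof.
by rewrite ler_norml dot_hnorm_le lerNl -dotNl -[hnorm x]hnormN dot_hnorm_le.
Qed.

Lemma hnormD x y : hnorm (x + y) <= hnorm x + hnorm y.
Proof.
apply: hnorm_le; first by rewrite addr_ge0 ?hnorm_ge0.
rewrite !dotE (dotC y x) -!hnorm_sqr.
have := dot_hnorm_le x y; lra.
Qed.

Lemma hnormB x y : hnorm (x - y) <= hnorm x + hnorm y.
Proof. by rewrite (le_trans (hnormD _ _))// hnormN. Qed.

Lemma hdistC x y : hnorm (x - y) = hnorm (y - x).
Proof. by rewrite -hnormN opprB. Qed.

Lemma hdist_le x y z : hnorm (x - z) <= hnorm (x - y) + hnorm (y - z).
Proof. by rewrite -(subrKA y x (-z)) hnormD. Qed.

(** Convergence in norm, phrased through the scalar sequence of distances: it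
    applies to product spaces, which carry only an inner product here. *)
Definition hcvg (w : nat -> V) (l : V) := hnorm (w n - l) @[n --> \oo] --> 0.

Definition hilbert := forall w : nat -> V,
  (forall e : R, 0 < e -> exists N, forall i j, (N <= i)%N -> (N <= j)%N ->
     hnorm (w i - w j) <= e) ->
  exists l, hcvg w l.

Lemma hcvg_dot w l u : hcvg w l -> dot (w n) u @[n --> \oo] --> dot l u.
Proof.
move=> wl; apply: (iffLR (subr_cvg0 _ _)).
apply: (@normr_le_cvg0 _ _ _ _ (fun n => hnorm (w n - l) * hnorm u)).
  by move=> n; rewrite -dotNl -dotDl normr_dot_le.
by rewrite -(mul0r (hnorm u)); apply: cvgM => //; exact: cvg_cst.
Qed.

Lemma hcvg_dotr w l u : hcvg w l -> dot u (w n) @[n --> \oo] --> dot u l.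
Proof. by move=> /(@hcvg_dot _ _ u); rewrite dotC; under eq_fun do rewrite dotC. Qed.

Lemma hcvg_sqr w l : hcvg w l -> dot (w n) (w n) @[n --> \oo] --> dot l l.
Proof.
move=> wl.
have -> : (fun n => dot (w n) (w n)) =
    (fun n => hnorm (w n - l) ^+ 2 + 2 * dot (w n) l - dot l l).
  by apply/funext => n; rewrite hnorm_sqr !dotE (dotC l (w n)); ring.
rewrite (_ : nbhs (dot l l) = nbhs (0 ^+ 2 + 2 * dot l l - dot l l)); last first.
  by congr nbhs; ring.
apply: cvgB; last exact: cvg_cst.
apply: cvgD; first by apply: cvgM.
by apply: cvgM; [exact: cvg_cst|exact: hcvg_dot].
Qed.

End DotTheory.

(** * Minimization over a convex epigraph, Riesz representation *)

(** The first-order condition at an end point: if b were negative, the step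
    - b / (a - b) would decrease t * b + t^2 * a below 0. *)
Lemma slope_ge0 (R : realFieldType) (a b : R) : 0 <= a ->
  (forall t, 0 < t <= 1 -> 0 <= t * b + t ^+ 2 * a) -> 0 <= b.
Proof.
move=> a0 h; rewrite leNgt; apply/negP => b0.
have ab : 0 < a - b by lra.
have t0 : 0 < - b / (a - b) by rewrite divr_gt0// oppr_gt0.
have t1 : - b / (a - b) <= 1 by rewrite ler_pdivrMr// mul1r; lra.
have := h (- b / (a - b)); rewrite t0 t1 => /(_ isT).
rewrite expr2 -mulrA -mulrDr pmulr_rge0//.
have -> : b + - b / (a - b) * a = - b ^+ 2 / (a - b) by field; rewrite gt_eqF.
by rewrite leNgt mulNr oppr_lt0 divr_gt0// exprn_even_gt0//= lt_eqF.
Qed.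

Section Minimization.
Context {R : realType} {V : lmodType R} (dot : {dot V for idfun}).
Hypothesis V_hilbert : hilbert dot.
Variable E : V -> R -> Prop.
Hypothesis E_neq0 : exists w t, E w t.
Hypothesis E_convex : forall (c : R) w s w' s', 0 <= c <= 1 -> E w s -> E w' s' ->
  E ((1 - c) *: w + c *: w') ((1 - c) * s + c * s').
Hypothesis E_closed : forall (w : nat -> V) (s : nat -> R) w' (s' : R),
  (forall n, E (w n) (s n)) -> hcvg dot w w' -> s n @[n --> \oo] --> s' ->
  E w' s'.
Variable lb : R.
Hypothesis E_lb : forall w t, E w t -> lb <= t + dot w w / 2.

Let values := [set v | exists w t, E w t /\ v = t + dot w w / 2].

Let values_inf : has_inf values.
Proof.
split; first by have [w [t Ewt]] := E_neq0; exists (t + dot w w / 2), w, t.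
by exists lb => _ [w [t [Ewt ->]]]; exact: E_lb.
Qed.

Let m := inf values.

Let m_le w t : E w t -> m <= t + dot w w / 2.
Proof. by move=> Ewt; apply: ge_inf; [exact: values_inf.2|exists w, t]. Qed.

Let minimizer_exists : exists w t, E w t /\ t + dot w w / 2 = m.
Proof.
have /choice[f fP] : forall n : nat, exists p : V * R,
    E p.1 p.2 /\ p.2 + dot p.1 p.1 / 2 <= m + n.+1%:R^-1.
  move=> n; have [|_ [w [t [Ewt ->]]] /ltW lt_m] :=
    @inf_adherent _ values n.+1%:R^-1 _ values_inf; first by rewrite invr_gt0.
  by exists (w, t).
pose w n := (f n).1; pose s n := (f n).2.
have Ews n : E (w n) (s n) by have [] := fP n.
have ws_le n : s n + dot (w n) (w n) / 2 <= m + n.+1%:R^-1 by have [] := fP n.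
(* the midpoint of two almost minimizers is no better than the infimum *)
have wB i j : dot (w i - w j) (w i - w j) <= 4 * (i.+1%:R^-1 + j.+1%:R^-1).
  have h2 : 0 <= (1 / 2 : R) <= 1 by lra.
  have := m_le (E_convex h2 (Ews i) (Ews j)).
  have := ws_le i; have := ws_le j.
  rewrite !dotE (dotC dot (w j) (w i)).
  by   move: (i.+1%:R^-1) (j.+1%:R^-1) => ei ej; lra.
have [l wl] : exists l, hcvg dot w l.
  apply: V_hilbert => e e0.
  have e8 : 0 < e ^+ 2 / 8 by rewrite divr_gt0// exprn_gt0.
  have [N _ Ne] := near_infty_natSinv_lt (PosNum e8).
  exists N => i j Ni Nj; apply: hnorm_le; first exact: ltW.
  have /= := Ne i Ni; have /= := Ne j Nj; have := wB i j.
  by move: (i.+1%:R^-1) (j.+1%:R^-1) => ei ej; lra.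
have vm : s n + dot (w n) (w n) / 2 @[n --> \oo] --> m.
  apply: (@squeeze_cvgr _ _ _ _ (cst m) (fun n => m + n.+1%:R^-1)).
  - by apply: nearW => n; rewrite m_le//= ws_le.
  - exact: cvg_cst.
  - rewrite (_ : nbhs m = nbhs (m + 0)); last by rewrite addr0.
    apply: cvgD; first exact: cvg_cst.
    exact: cvg_harmonic.
have sl : s n @[n --> \oo] --> m - dot l l / 2.
  rewrite (_ : s = fun n => s n + dot (w n) (w n) / 2 - dot (w n) (w n) / 2).
    by apply: cvgB => //; apply: cvgM; [exact: hcvg_sqr|exact: cvg_cst].
  by apply/funext => n; rewrite addrK.
exists l, (m - dot l l / 2); split; last by rewrite subrK.
exact: E_closed Ews wl sl.
Qed.

(** The strongly convex function t + |w|^2 / 2 attains its minimum on a closed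
    convex set of pairs (w, t), and the minimizer satisfies the variational
    inequality obtained by moving towards any other pair. Using epigraphs
    instead of functions avoids infinite values. *)
Lemma convex_epigraph_min : exists w t, E w t /\
  forall w' t', E w' t' -> 0 <= t' - t + dot w (w' - w).
Proof.
have [w [t [Ewt mE]]] := minimizer_exists.
exists w, t; split => // w' t' Ewt'.
apply: (@slope_ge0 _ (dot (w' - w) (w' - w) / 2)) => [|c /andP[c0 c1]].
  by rewrite divr_ge0// dot_ge0.
have c01 : 0 <= c <= 1 by rewrite ltW.
have := m_le (E_convex c01 Ewt Ewt').
rewrite -mE !dotE (dotC dot w' w) => h.
rewrite -subr_ge0 in h; apply: le_trans h _; rewrite le_eqVlt; apply/orP; left.
by apply/eqP; field.
Qed.

End Minimization.

Section Riesz.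
Context {R : realType} {V : lmodType R} (dot : {dot V for idfun}).
Hypothesis V_hilbert : hilbert dot.

(** The epigraph of - phi is minimized where the derivative of
    |w|^2 / 2 - phi w vanishes, that is where dot w = phi. *)
Lemma riesz (phi : V -> R) (K : R) :
  (forall c x y, phi (c *: x + y) = c * phi x + phi y) ->
  (forall x, phi x <= K * hnorm dot x) ->
  exists c, forall x, phi x = dot c x.
Proof.
move=> phiP phi_le.
have phi0 : phi 0 = 0.
  have := phiP 1 0 0; rewrite scale1r addr0 mul1r; lra.
have phiZ c x : phi (c *: x) = c * phi x.
  by have := phiP c x 0; rewrite phi0 !addr0.
have phiD x y : phi (x + y) = phi x + phi y.
  by have := phiP 1 x y; rewrite scale1r mul1r.
have phiN x : phi (- x) = - phi x by rewrite -scaleN1r phiZ mulN1r.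
have phi_norm x : `|phi x| <= K * hnorm dot x.
  by rewrite ler_norml phi_le andbT lerNl -phiN -[hnorm _ x]hnormN phi_le.
have [|c w s w' s' /andP[c0 c1]|w s w' s' ws ww' ss'|w t|c [t [ct cP]]] :=
  @convex_epigraph_min R V dot V_hilbert (fun w t => - phi w <= t)
    _ _ _ (- (K ^+ 2 / 2)).
- by exists 0, 0; rewrite phi0 oppr0.
- move=> h1 h2; rewrite phiD !phiZ opprD -!mulrN.
  by apply: lerD; apply: ler_wpM2l => //; rewrite subr_ge0.
- apply: ler_cvg_to ss' _; last by apply: nearW => n; exact: ws.
  apply: cvgN; apply: (iffLR (subr_cvg0 _ _)).
  apply: (@normr_le_cvg0 _ _ _ _ (fun n => K * hnorm dot (w n - w'))).
    by move=> n; rewrite -phiN -phiD.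
  by rewrite -(mulr0 K); apply: cvgM => //; exact: cvg_cst.
- move=> wt; have := phi_norm w; rewrite ler_norml => /andP[_ h].
  rewrite -hnorm_sqr; have := sqr_ge0 (hnorm dot w - K); lra.
exists c => x; apply/eqP; rewrite eq_le; apply/andP; split.
  have := cP (c + x) (- phi (c + x)) (lexx _).
  rewrite (addrC c x) addrK phiD; lra.
have := cP (c - x) (- phi (c - x)) (lexx _).
rewrite (addrC c (- x)) addrK phiD phiN dotNr; lra.
Qed.

Lemma ultra_bounded_cvg (U : set_system nat) (u : nat -> R) (K : R) :
  UltraFilter U -> (forall n, `|u n| <= K) -> cvg (u n @[n --> U]).
Proof.
move=> UU uK.
have [|l [_ /= clul]] := @segment_compact R (- K) K (u @ U) _.
  by apply: nearW => n; rewrite /= in_itv/= -ler_norml.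
apply/cvg_ex; exists l => A lA.
have [//|UA] := in_ultra_setVsetC (u @^-1` A) UU.
by have [y []] := clul (~` A) A UA lA.
Qed.

(** The limits of dot (z n) x along the ultrafilter form a bounded linear
    functional of x, which Riesz's theorem represents. Ultrafilters
    take the place of extracted subsequences. *)
Lemma ultra_weak_cvg (U : set_system nat) (z : nat -> V) (K : R) :
  UltraFilter U -> (forall n, hnorm dot (z n) <= K) ->
  exists c, forall x, dot (z n) x @[n --> U] --> dot c x.
Proof.
move=> UU zK.
have cvgz x : cvg (dot (z n) x @[n --> U]).
  apply: (@ultra_bounded_cvg _ _ (K * hnorm dot x)) => n.
  by rewrite (le_trans (normr_dot_le _ _ _))// ler_wpM2r// hnorm_ge0.
have [|x|c cP] := @riesz (fun x => lim (dot (z n) x @[n --> U])) K.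
- move=> c x y; apply: cvg_lim => //.
  under eq_fun do rewrite dotDr dotZr.
  by apply: cvgD => //; apply: cvgM => //; exact: cvg_cst.
- apply: limr_le => //; apply: nearW => n.
  rewrite (le_trans (dot_hnorm_le _ _ _))// ler_wpM2r// hnorm_ge0//.
by exists c => x; rewrite -cP; exact: cvgz.
Qed.

End Riesz.

(** Otherwise some neighborhood is missed on a set that meets every tail, and
    an ultrafilter refining the trace of the tails on that set contradicts the
    hypothesis. *)
Lemma cvg_ultra (R : realType) (u : nat -> R) (l : R) :
  (forall U : set_system nat, UltraFilter U -> \oo `<=` U -> u n @[n --> U] --> l) ->
  u n @[n --> \oo] --> l.
Proof.
move=> ul A lA; apply: contrapT => nA.
have PF : ProperFilter (within (~` (u @^-1` A)) \oo).
  apply: Build_ProperFilter_ex => B; rewrite /within/= => BP.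
  apply: contrapT => nB; apply: nA.
  apply: filterS BP => n nAn; apply: contrapT => An; apply: nB.
  by exists n; exact: nAn.
have [U [UU sU]] := ultraFilterLemma PF.
have UA : U (u @^-1` A).
  by apply: ul => // B B1; apply: sU; apply: filterS B1 => n Bn _.
have UnA : U (~` (u @^-1` A)) by apply: sU; exact: nearW.
by have [n []] := filter_ex (filterI UA UnA).
Qed.

(** * Weighted products of Hilbert spaces *)

Section WeightedProduct.
Context {R : realType} {V : lmodType R} (dot : {dot V for idfun}).
Context {I : finType} {w : I -> R}.

(** Positivity of the weights is an argument, so that the inner product
    structure can be attached to the function itself. *)
Definition wdot (w_gt0 : forall i, 0 < w i) (f g : I -> V) : R :=
  \sum_i w i * dot (f i) (g i).

Variable w_gt0 : forall i, 0 < w i.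
Local Notation wd := (wdot w_gt0).

Let wdotBl g : zmod_morphism (wd ^~ g).
Proof.
move=> f f'; rewrite /wdot -sumrB; apply: eq_bigr => i _.
by rewrite -mulrBr dotDl dotNl.
Qed.

Let wdotBr f : zmod_morphism (wd f).
Proof.
move=> g g'; rewrite /wdot -sumrB; apply: eq_bigr => i _.
by rewrite -mulrBr dotDr dotNr.
Qed.

Let wdotZl g : scalable_for *%R (wd ^~ g).
Proof.
move=> c f; rewrite /wdot /= mulr_sumr; apply: eq_bigr => i _.
by rewrite mulrCA dotZl.
Qed.

Let wdotZr f : scalable_for (idfun \; *%R) (wd f).
Proof.
move=> c g; rewrite /wdot /= mulr_sumr; apply: eq_bigr => i _.
by rewrite mulrCA dotZr.
Qed.

HB.instance Definition _ := @isBilinear.Build R (I -> V) (I -> V) R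
  *%R (idfun \; *%R) wd wdotBl wdotBr wdotZl wdotZr.

Let wdot_sym f g : wd f g = (-1) ^+ false * idfun (wd g f).
Proof.
by rewrite mul1r /= /wdot; apply: eq_bigr => i _; rewrite dotC.
Qed.

HB.instance Definition _ :=
  @isHermitianSesquilinear.Build R (I -> V) false idfun wd wdot_sym.

Let wdot_gt0 f : f != 0 -> 0 < wd f f.
Proof.
move=> f0; have [i fi] : exists i, f i != 0.
  apply: contrapT => h; move/eqP: f0; apply; apply/funext => i.
  by apply/eqP; apply: contrapT => fi; apply: h; exists i; exact/negP.
rewrite /wdot (bigD1 i)//= ltr_pwDl ?mulr_gt0 ?dot_gt0//.
by apply: sumr_ge0 => j _; rewrite mulr_ge0 ?dot_ge0// ltW.
Qed.

HB.instance Definition _ := @isDotProduct.Build R (I -> V) wd wdot_gt0.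

Lemma hnorm_wdot_le (f : I -> V) :
  hnorm wd f <= \sum_i Num.sqrt (w i) * hnorm dot (f i).
Proof.
have t0 i : 0 <= Num.sqrt (w i) * hnorm dot (f i).
  by rewrite mulr_ge0 ?sqrtr_ge0.
apply: hnorm_le; first exact: sumr_ge0.
rewrite expr2 mulr_suml; apply: ler_sum => i _.
rewrite -hnorm_sqr -{1}(sqr_sqrtr (ltW (w_gt0 i))) -exprMn expr2 ler_wpM2l//.
by rewrite (bigD1 i)//= lerDl sumr_ge0.
Qed.

Lemma hnorm_proj_le (f : I -> V) i :
  hnorm dot (f i) <= hnorm wd f / Num.sqrt (w i).
Proof.
rewrite ler_pdivlMr ?sqrtr_gt0// mulrC /hnorm -sqrtrM ?(ltW (w_gt0 i))//.
rewrite ler_wsqrtr// [leRHS](bigD1 i)//= lerDl.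
by apply: sumr_ge0 => j _; rewrite mulr_ge0 ?dot_ge0// ltW.
Qed.

Lemma hilbert_wdot : hilbert dot -> hilbert wd.
Proof.
move=> V_hilbert f f_cauchy.
have /choice[l fl] : forall i, exists l, hcvg dot (f ^~ i) l.
  move=> i; apply: V_hilbert => e e0.
  have si : 0 < Num.sqrt (w i) by rewrite sqrtr_gt0.
  have [N Nf] := f_cauchy (e * Num.sqrt (w i)) (mulr_gt0 e0 si).
  exists N => j k Nj Nk; apply: le_trans (hnorm_proj_le (f j - f k) i) _.
  by rewrite ler_pdivrMr// Nf.
exists l; apply: (@normr_le_cvg0 _ _ _ _
    (fun n => \sum_i Num.sqrt (w i) * hnorm dot (f n i - l i))).
  by move=> n; rewrite ger0_norm ?hnorm_ge0// (hnorm_wdot_le (f n - l)).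
rewrite (_ : nbhs 0 = nbhs (\sum_(i : I) Num.sqrt (w i) * 0)); last first.
  by rewrite big1// => i _; rewrite mulr0.
apply: cvg_big => [|i _]; first exact: add_continuous.
apply: cvgM; [exact: cvg_cst|exact: fl].
Qed.

End WeightedProduct.

(** * Minty's theorem *)

Section Minty.
Context {R : realType} {V : lmodType R} (dot : {dot V for idfun}).
Hypothesis V_hilbert : hilbert dot.

Definition monotonically_related (M : V -> set V) x u :=
  forall y v, M y v -> 0 <= dot (x - y) (u - v).

Let one_gt0 (b : bool) : 0 < (fun=> 1 : R) b := ltr01.

(** The proof of Simons and Zalinescu. On pairs (x, u), encoded as functions
    f on bool with f true = x and f false = u, the set [E] below is the
    epigraph of the Fitzpatrick function
      F (x, u) = sup of <x, v> + <y, u> - <y, v> over the graph points (y, v),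
    for which F (x, u) >= <x, u> by maximality. If (x, u) minimizes
    F + (|x|^2 + |u|^2) / 2, the variational inequality tested on the graph says
    that (- u, - x) is monotonically related to M, hence lies in the graph;
    tested at that very point it gives x = - u. *)
Lemma minty0 (M : V -> set V) :
  (forall x u, M x u -> monotonically_related M x u) ->
  (forall x u, monotonically_related M x u -> M x u) ->
  exists x, M x (- x).
Proof.
move=> M_mono M_max.
pose E (f : bool -> V) (t : R) := forall y v, M y v ->
  dot (f true) v + dot y (f false) - dot y v <= t.
have E_lb f t : E f t -> dot (f true) (f false) <= t.
  move=> Eft; rewrite leNgt; apply/negP => lt.
  have /M_max Mf : monotonically_related M (f true) (f false).
    move=> y v Myv; have := Eft _ _ Myv.
    by rewrite !dotE; lra.
  by have := Eft _ _ Mf; lra.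
have E_graph y v : M y v -> E (fun b => if b then y else v) (dot y v).
  move=> Myv y' v' Myv'; have := M_mono _ _ Myv _ _ Myv'.
  by rewrite !dotE /=; lra.
pose dot2 : {dot (bool -> V) for idfun} := wdot dot one_gt0.
have dot2E (f g : bool -> V) : dot2 f g =
    dot (f true) (g true) + dot (f false) (g false).
  by rewrite /= /wdot big_bool !mul1r.
(* the lower bound 0 holds because F (x, u) >= <x, u> and
    (|x|^2 + |u|^2) / 2 + <x, u> = |x + u|^2 / 2 *)
have [|c f s f' s' /andP[c0 c1]|f s f' s' fs ff' ss'|f t|f [t [Eft ftP]]] :=
  @convex_epigraph_min R (bool -> V) dot2
    (hilbert_wdot V_hilbert) E _ _ _ 0.
(* an empty graph would make every pair monotonically related to it *)
- apply: contrapT => E0.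
  have M0 : M 0 0.
    by apply: M_max => y v Myv; case: E0; do 2 eexists; exact: E_graph _ _ Myv.
  by apply: E0; do 2 eexists; exact: E_graph M0.
- move=> Efs Efs' y v Myv.
  have h1 : (1 - c) * (dot (f true) v + dot y (f false) - dot y v) <= (1 - c) * s.
    by rewrite ler_wpM2l ?subr_ge0// Efs.
  have h2 : c * (dot (f' true) v + dot y (f' false) - dot y v) <= c * s'.
    by rewrite ler_wpM2l// Efs'.
  rewrite /= !dotE; lra.
- move=> y v Myv; apply: (ler_cvg_to _ ss'); last first.
    by apply: nearW => n; exact: fs Myv.
  have cvgf b : hcvg dot (fun n => f n b) (f' b).
    apply: (@normr_le_cvg0 _ _ _ _
      (fun n => hnorm dot2 (f n - f') / Num.sqrt 1)).
      move=> n; rewrite ger0_norm ?hnorm_ge0//.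
      exact: (hnorm_proj_le dot one_gt0 (f n - f') b).
    by rewrite -(mul0r (Num.sqrt 1)^-1); apply: cvgM => //; exact: cvg_cst.
  apply: cvgB; last exact: cvg_cst.
  by apply: cvgD; [exact: hcvg_dot|exact: hcvg_dotr].
- move=> /E_lb; rewrite dot2E => h.
  have := dot_ge0 dot (f true + f false).
  by rewrite !dotE (dotC dot (f false) (f true)); lra.
have key y v : M y v -> 0 <= dot (- f false - y) (- f true - v) -
    dot (f true + f false) (f true + f false).
  move=> Myv; have := ftP _ _ (E_graph _ _ Myv); have := E_lb _ _ Eft.
  rewrite dot2E /= !dotE (dotC dot (f false) (f true)).
  by rewrite (dotC dot y (f true)); lra.
have Mf : M (- f false) (- f true).
  apply: M_max => y v Myv; have := key _ _ Myv.
  by have := dot_ge0 dot (f true + f false); lra.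
have /dot_le0 f0 : dot (f true + f false) (f true + f false) <= 0.
  by have := key _ _ Mf; rewrite !subrr dot0l; lra.
have fE : f true = - f false by apply/eqP; rewrite -addr_eq0 f0.
by exists (- f false); rewrite -[X in M _ (- X)]fE.
Qed.

Lemma minty (M : V -> set V) :
  (forall x u, M x u -> monotonically_related M x u) ->
  (forall x u, monotonically_related M x u -> M x u) ->
  forall s, exists x, M x (s - x).
Proof.
move=> M_mono M_max s.
have [x u Mxu y v Myv|x u xuP|x Mx] := @minty0 (fun x => [set u | M x (u + s)]).
- by have := M_mono _ _ Mxu _ _ Myv; rewrite opprD addrACA subrr addr0.
- apply: M_max => y v Myv; have := xuP y (v - s).
  by rewrite /= subrK opprB addrA; exact.
by exists x; rewrite addrC.
Qed.

End Minty.

(** * Krasnoselskii-Mann iterations with summable errors *)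

(** Subtracting the partial sums of e leaves a sequence that is nonincreasing
    and bounded below. *)
Lemma quasi_nonincreasing_cvg (R : realType) (u e : nat -> R) :
  (forall n, 0 <= u n) -> (forall n, 0 <= e n) ->
  (forall n, u n.+1 <= u n + e n) -> cvgn (series e) -> cvgn u.
Proof.
move=> u0 e0 ue cvg_e.
have nd_e : nondecreasing_seq (series e).
  by apply: nondecreasing_series => n _ _; exact: e0.
have cvg_ue : cvgn (u - series e).
  apply: nonincreasing_is_cvgn.
    apply/nonincreasing_seqP => n; rewrite !fctE /series/= big_nat_recr//=.
    by have := ue n; lra.
  exists (- limn (series e)) => _ [n _ <-]; rewrite !fctE.
  by have := nondecreasing_cvgn_le nd_e cvg_e n; have := u0 n; lra.
rewrite (_ : u = u - series e + series e); first exact: is_cvgD.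
by rewrite subrK.
Qed.

(** The decrements v telescope against u, up to the summable e. *)
Lemma cvg_series_decrement (R : realType) (u v e : nat -> R) (K : R) :
  (forall n, 0 <= u n) -> (forall n, 0 <= v n) -> (forall n, 0 <= e n) ->
  (forall n, u n.+1 + v n <= u n + e n) -> cvgn (series e) ->
  cvgn (series v).
Proof.
move=> u0 v0 e0 uve cvg_e.
have nd_e : nondecreasing_seq (series e).
  by apply: nondecreasing_series => n _ _; exact: e0.
apply: nondecreasing_is_cvgn.
  by apply: nondecreasing_series => n _ _; exact: v0.
exists (u 0%N + limn (series e)) => _ [n _ <-].
apply: le_trans (_ : u 0%N + series e n <= _); last first.
  by rewrite lerD2l (nondecreasing_cvgn_le nd_e cvg_e).
suff : u n + series v n <= u 0%N + series e n by have := u0 n; lra.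
elim: n => [|n ih]; first by rewrite /series/= !big_geq.
move: ih; rewrite /series/= !big_nat_recr//=.
by have := uve n; lra.
Qed.

Section KrasnoselskiiMann.
Context {R : realType} {V : lmodType R} (dot : {dot V for idfun}).
Hypothesis V_hilbert : hilbert dot.
Variable T : V -> V.
Hypothesis T_nonexp : forall x y, hnorm dot (T x - T y) <= hnorm dot (x - y).
Variables (mu : nat -> R) (z e : nat -> V).
Hypothesis mu_01 : forall n, 0 <= mu n <= 1.
Hypothesis mu_sum : ~ cvgn (series (fun n => mu n * (1 - mu n))).
Hypothesis e_sum : cvgn (series (fun n => hnorm dot (e n))).
Hypothesis zE : forall n, z n.+1 = z n + mu n *: (T (z n) - z n) + e n.

Let norm_e_ge0 n : 0 <= hnorm dot (e n). Proof. exact: hnorm_ge0. Qed.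

Let step_le f n : T f = f ->
  dot (z n + mu n *: (T (z n) - z n) - f) (z n + mu n *: (T (z n) - z n) - f) +
    mu n * (1 - mu n) * hnorm dot (T (z n) - z n) ^+ 2 <=
  hnorm dot (z n - f) ^+ 2.
Proof.
move=> Tf; have /andP[mu0 mu1] := mu_01 n.
have -> : z n + mu n *: (T (z n) - z n) - f =
    (z n - f) + mu n *: ((T (z n) - f) - (z n - f)).
  by rewrite opprB subrKA addrAC.
have -> : T (z n) - z n = (T (z n) - f) - (z n - f) by rewrite opprB subrKA.
have Tle : hnorm dot (T (z n) - f) <= hnorm dot (z n - f).
  by rewrite -{1}Tf T_nonexp.
move: Tle; move: (T (z n) - f) (z n - f) => b a ba.
have ba2 : mu n * dot b b <= mu n * dot a a.
  by rewrite ler_wpM2l// -!hnorm_sqr ler_pXn2r ?nnegrE ?hnorm_ge0.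
move: ba2; rewrite !hnorm_sqr !dotE (dotC dot b a); lra.
Qed.

Lemma KM_dist_cvg f : T f = f -> cvgn (fun n => hnorm dot (z n - f)).
Proof.
move=> Tf; apply: (quasi_nonincreasing_cvg _ norm_e_ge0 _ e_sum) => n.
  exact: hnorm_ge0.
rewrite zE addrAC (le_trans (hnormD _ _ _))// lerD2r.
apply: hnorm_le; first exact: hnorm_ge0.
apply: le_trans (step_le n Tf); rewrite lerDl.
have /andP[mu0 mu1] := mu_01 n.
by rewrite mulr_ge0 ?sqr_ge0// mulr_ge0// subr_ge0.
Qed.

Lemma KM_bounded f : T f = f -> exists K, forall n, hnorm dot (z n - f) <= K.
Proof.
move=> /KM_dist_cvg/cvg_seq_bounded[K [_ /(_ (K + 1))]].
rewrite ltrDl ltr01 => /(_ isT) h; exists (K + 1) => n.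
by apply: le_trans (h n I); rewrite ler_norm.
Qed.

Hypothesis T_fix : exists f, T f = f.

(** The residuals increase by at most twice the errors, hence converge. Their
    limit is 0: the squared distance to a fixed point loses
    mu (1 - mu) |T z - z|^2 at each step, so these terms are summable, while
    mu (1 - mu) is not. *)
Lemma KM_residual_cvg0 : hnorm dot (T (z n) - z n) @[n --> \oo] --> 0.
Proof.
pose r n := hnorm dot (T (z n) - z n).
have r_cvg : cvgn r.
  apply: (@quasi_nonincreasing_cvg _ _ (fun n => 2 * hnorm dot (e n))) => [n|n|n|].
  - exact: hnorm_ge0.
  - by rewrite mulr_ge0.
  - have /andP[mu0 mu1] := mu_01 n.
    rewrite /r; set tz := T (z n.+1); set d := T (z n) - z n.
    have -> : tz - z n.+1 = (tz - T (z n)) + (1 - mu n) *: d - e n.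
      rewrite zE -/d scalerBl scale1r addrA /d subrKA !opprD !addrA.
      by [].
    have tz_le : hnorm dot (tz - T (z n)) <= mu n * hnorm dot d + hnorm dot (e n).
      apply: le_trans (T_nonexp _ _) _.
      rewrite zE -/d -(addrA (z n)) addrAC subrr add0r (le_trans (hnormD _ _ _))//.
      by rewrite hnormZ ger0_norm.
    apply: le_trans (hnormB _ _ _) _.
    apply: le_trans (lerD (hnormD _ _ _) (lexx _)) _.
    rewrite hnormZ ger0_norm ?subr_ge0//; lra.
  - exact: is_cvg_seriesZ.
have r0 n : 0 <= r n by exact: hnorm_ge0.
have [f Tf] := T_fix; have [K zK] := KM_bounded Tf.
have [C eC] : exists C, forall n, hnorm dot (e n) <= C.
  have /cvgP/cvg_seq_bounded[C [_ /(_ (C + 1))]] := cvg_series_cvg_0 e_sum.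
  rewrite ltrDl ltr01 => /(_ isT) h; exists (C + 1) => n.
  by apply: le_trans (h n I); rewrite ler_norm.
have K0 : 0 <= K by apply: le_trans (zK 0%N); exact: hnorm_ge0.
have C0 : 0 <= C by apply: le_trans (eC 0%N).
have m0 n : 0 <= mu n * (1 - mu n).
  by have /andP[mu0 mu1] := mu_01 n; rewrite mulr_ge0// subr_ge0.
have sum_r : cvgn (series (fun n => mu n * (1 - mu n) * r n ^+ 2)).
  apply: (@cvg_series_decrement _ (fun n => hnorm dot (z n - f) ^+ 2) _
    (fun n => (2 * K + C) * hnorm dot (e n))) => // [n|n|n|n|].
  - exact: sqr_ge0.
  - by rewrite mulr_ge0 ?sqr_ge0.
  - by rewrite mulr_ge0// addr_ge0// mulr_ge0.
  - have := step_le n Tf; rewrite -/(r n) -hnorm_sqr.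
    set v := z n + _ => vf_le.
    have zv : hnorm dot (z n.+1 - f) <= hnorm dot (v - f) + hnorm dot (e n).
      by rewrite zE addrAC hnormD.
    have vK : hnorm dot (v - f) <= K.
      apply: le_trans (zK n); rewrite -(@ler_pXn2r _ 2) ?nnegrE ?hnorm_ge0//.
      by have := mulr_ge0 (m0 n) (sqr_ge0 (r n)); lra.
    have zv2 : hnorm dot (z n.+1 - f) ^+ 2 <=
        (hnorm dot (v - f) + hnorm dot (e n)) ^+ 2.
      by rewrite ler_pXn2r ?nnegrE ?addr_ge0 ?hnorm_ge0.
    have h1 : hnorm dot (v - f) * hnorm dot (e n) <= K * hnorm dot (e n).
      by rewrite ler_wpM2r.
    have h2 : hnorm dot (e n) * hnorm dot (e n) <= C * hnorm dot (e n).
      by rewrite ler_wpM2r.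
    lra.
  - exact: is_cvg_seriesZ.
have rho0 : 0 <= limn r by apply: limr_ge => //; exact: nearW.
suff rho : limn r = 0 by rewrite -rho.
apply: contrapT => /eqP rho_neq0.
have rho_gt0 : 0 < limn r by rewrite lt0r rho_neq0.
apply: mu_sum.
have [N _ rN] : \forall n \near \oo, limn r / 2 <= r n.
  by apply: (cvgr_ge _ r_cvg); lra.
have v0 n : 0 <= (limn r / 2) ^- 2 * (mu n * (1 - mu n) * r n ^+ 2).
  by apply: mulr_ge0; [rewrite invr_ge0 sqr_ge0|apply: mulr_ge0; [|exact: sqr_ge0]].
(* only the terms past N, where r is at least half its limit, are compared *)
pose u n := if (n < N)%N then 0 else mu n * (1 - mu n).
have u_cvg : cvgn (series u).
  apply: (@series_le_cvg _ _ (fun n => (limn r / 2) ^- 2 *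
      (mu n * (1 - mu n) * r n ^+ 2))) => [n|n|n|].
  - rewrite /u; case: ifP => _; [by []|exact: m0].
  - exact: v0.
  - rewrite /u; case: ltnP => Nn; first exact: v0.
    rewrite mulrCA ler_peMr// mulrC ler_pdivlMr ?exprn_gt0 ?divr_gt0//.
    by rewrite mul1r ler_pXn2r ?nnegrE// ?(rN n Nn)// divr_ge0.
  - exact: is_cvg_seriesZ.
rewrite -(is_cvg_series_restrict N).
rewrite (_ : [sequence _]_n = [sequence \sum_(N <= k < n) u k]_n).
  by rewrite is_cvg_series_restrict.
apply/funext => n /=; apply: eq_big_nat => k /andP[Nk _].
by rewrite /u ltnNge Nk.
Qed.

(** Opial's argument along ultrafilters. A weak limit c of z along an
    ultrafilter is a fixed point, since T z - z tends to 0 and T is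
    nonexpansive. If c and c' are two of them, the distances of z to c and to c'
    converge, hence so does dot (z n) (c - c'); its limit is both dot c (c - c')
    and dot c' (c - c'), so that c = c'. *)
Lemma KM_weak_cvg : exists2 c, T c = c &
  forall u, dot (z n) u @[n --> \oo] --> dot c u.
Proof.
have [f Tf] := T_fix; have [K zK] := KM_bounded Tf.
have zK' n : hnorm dot (z n) <= K + hnorm dot f.
  by rewrite -[z n](subrK f) (le_trans (hnormD _ _ _))// lerD2r.
have lim_fix (U : set_system nat) c : UltraFilter U -> \oo `<=` U ->
    (forall u, dot (z n) u @[n --> U] --> dot c u) -> T c = c.
  move=> UU sU cP; apply/eqP; rewrite eq_sym -subr_eq0.
  apply/eqP/(@dot_le0 _ _ dot).
  pose r n := hnorm dot (T (z n) - z n).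
  pose L := K + hnorm dot f + hnorm dot c.
  have zcL n : hnorm dot (z n - c) <= L.
    by rewrite (le_trans (hnormB _ _ _))// lerD2r.
  have rU : r n @[n --> U] --> 0 by apply: cvg_trans KM_residual_cvg0; exact: cvg_app.
  pose g n := r n ^+ 2 + 2 * L * r n - 2 * (dot (z n) (c - T c) - dot c (c - T c)).
  have gU : g n @[n --> U] -->
      (0 ^+ 2 + 2 * L * 0 - 2 * (dot c (c - T c) - dot c (c - T c)) : R).
    apply: cvgB.
      by apply: cvgD; [exact: cvgM|apply: cvgM => //; exact: cvg_cst].
    apply: cvgM; first exact: cvg_cst.
    by apply: cvgB; [exact: cP|exact: cvg_cst].
  have {gU} : g n @[n --> U] --> (0 : R).
    by move: gU; rewrite subrr expr2 !mulr0 addr0 subr0.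
  move/cvgr_to_ge; apply; apply: nearW => n.
  have zTc : hnorm dot (z n - T c) <= r n + hnorm dot (z n - c).
    rewrite (le_trans (hdist_le _ _ (T (z n)) _))// hdistC lerD//.
  have : hnorm dot (z n - T c) ^+ 2 <= (r n + hnorm dot (z n - c)) ^+ 2.
    by rewrite ler_pXn2r ?nnegrE ?addr_ge0 ?hnorm_ge0.
  have rL : r n * hnorm dot (z n - c) <= r n * L.
    by rewrite ler_wpM2l ?hnorm_ge0.
  have -> : z n - T c = (z n - c) + (c - T c) by rewrite subrKA.
  rewrite hnorm_sqr /g; move: rL (hnorm_sqr dot (z n - c)).
  move: (r n) (hnorm dot (z n - c)) (c - T c) => rn nzc d.
  rewrite !dotE (dotC dot d (z n)) (dotC dot d c) (dotC dot c (z n)).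
  by move=> rL nzcE; rewrite sqrrD nzcE mulr2n; lra.
have unique c c' : T c = c -> T c' = c' -> exists l : R,
    dot (z n) (c - c') @[n --> \oo] --> l.
  move=> /KM_dist_cvg/cvg_ex[p zp] /KM_dist_cvg/cvg_ex[q zq].
  exists ((dot c c - dot c' c' - (p ^+ 2 - q ^+ 2)) / 2).
  rewrite (_ : (fun n => _) = fun n => (dot c c - dot c' c' -
    (hnorm dot (z n - c) ^+ 2 - hnorm dot (z n - c') ^+ 2)) / 2).
    apply: cvgM; last exact: cvg_cst.
    apply: cvgB; first exact: cvg_cst.
    by apply: cvgB; exact: cvgM.
  apply/funext => n; rewrite !hnorm_sqr !dotE.
  by rewrite (dotC dot c (z n)) (dotC dot c' (z n)); field.
have [U [UU sU]] := ultraFilterLemma eventually_filter.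
have [c cP] := ultra_weak_cvg V_hilbert UU zK'.
have Tc := lim_fix _ _ UU sU cP.
exists c => // u; apply: cvg_ultra => W WU sW.
have [c' cP'] := ultra_weak_cvg V_hilbert WU zK'.
have Tc' := lim_fix _ _ WU sW cP'.
have [l lP] := unique _ _ Tc Tc'.
suff -> : c = c' by [].
apply/eqP; rewrite -subr_eq0; apply/eqP/(@dot_le0 _ _ dot).
have e1 : dot c (c - c') = l.
  by apply: cvg_unique (cP _) _ => //; apply: cvg_trans lP; exact: cvg_app.
have e2 : dot c' (c - c') = l.
  by apply: cvg_unique (cP' _) _ => //; apply: cvg_trans lP; exact: cvg_app.
by rewrite dotDl dotNl e1 e2 subrr.
Qed.

End KrasnoselskiiMann.

(** * Averagedness of a three-operator splitting *)

Section ThreeOperatorEstimate.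
Context {R : realType} {V : lmodType R} (dot : {dot V for idfun}).
Variables (beta gamma : R) (d X q b : V).
Hypothesis gamma_ge0 : 0 <= gamma.
Hypothesis XX : dot X X = dot d X.
Hypothesis Xb : dot X b = dot d b.
Hypothesis coco : beta * dot b b <= dot d b.
Hypothesis firm : 0 <= dot q (2 *: X - d - gamma *: b - q).

(** Here d is a difference of two points, X the difference of their projections
    onto a subspace, b a difference of values in that subspace of a cocoercive
    map, and q a difference of values of a firmly nonexpansive map at points
    whose difference is 2 X - d - gamma b. The next iterates differ by
    d + (q - X), and d - gamma b is the difference after the forward step. The
    terms subtracted are the gains of two maps applied in turn: the forward
    step, by cocoercivity, and (Id + R_A R_P) / 2, which is firmly nonexpansive,
    with R_A and R_P the reflections of the resolvent and of the projection. *)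
Lemma three_operator_estimate :
  dot (d + (q - X)) (d + (q - X)) + dot (q - X + gamma *: b) (q - X + gamma *: b) +
    gamma * (2 * beta - gamma) * dot b b <= dot d d.
Proof.
have gcoco : 0 <= gamma * (dot d b - beta * dot b b).
  by rewrite mulr_ge0// subr_ge0.
move: gcoco firm; rewrite !dotE (dotC dot q d) (dotC dot q X) (dotC dot X d).
rewrite (dotC dot b q) (dotC dot b X) XX Xb; lra.
Qed.

(** With D = q - X, the identity
      2 beta |D + gamma b|^2 + 2 beta gamma (2 beta - gamma) |b|^2
        - (2 beta - gamma) |D|^2 = gamma |D + 2 beta b|^2
    and the lower bound on alpha turn the estimate into
    2 <d, D> + |D|^2 / alpha <= 0. *)
Lemma three_operator_averaged (alpha : R) : 0 < alpha -> 0 < beta ->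
  2 * beta <= alpha * (4 * beta - gamma) ->
  hnorm dot (d + alpha^-1 *: (q - X)) <= hnorm dot d.
Proof.
move=> alpha0 beta0 alphaP; apply: hnorm_le; first exact: hnorm_ge0.
have := three_operator_estimate; rewrite hnorm_sqr.
move: (q - X) => D; set c := alpha^-1 => est.
have c0 : 0 < c by rewrite invr_gt0.
have c_le : c * (2 * beta) <= 4 * beta - gamma.
  by rewrite /c mulrC ler_pdivrMr// [leRHS]mulrC.
have DD : c * (2 * beta) * dot D D <= (4 * beta - gamma) * dot D D.
  by rewrite ler_wpM2r// dot_ge0.
have sq : 0 <= gamma * dot (D + (2 * beta) *: b) (D + (2 * beta) *: b).
  by rewrite mulr_ge0// dot_ge0.
have best : 2 * beta * (dot (d + D) (d + D) +
    dot (D + gamma *: b) (D + gamma *: b) +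
    gamma * (2 * beta - gamma) * dot b b) <= 2 * beta * dot d d.
  by rewrite ler_pM2l// mulr_gt0.
have main : 2 * beta * (2 * dot d D + c * dot D D) <= 0.
  move: best sq; rewrite !dotE (dotC dot b D) (dotC dot D d); lra.
have {}main : 2 * dot d D + c * dot D D <= 0.
  by rewrite -(@pmulr_rle0 _ (2 * beta)) ?mulr_gt0.
have : c * (2 * dot d D + c * dot D D) <= 0 by rewrite pmulr_rle0.
by rewrite !dotE (dotC dot D d); lra.
Qed.

End ThreeOperatorEstimate.

(** * Resolvents of maximally monotone operators *)

Section Resolvent.
Context {R : realType} {H : completeNormedModType R} (dot : {dot H for idfun}).
Hypothesis normE : forall x : H, `|x| = Num.sqrt (dot x x).

Lemma hnormE x : hnorm dot x = `|x|.
Proof. by rewrite normE. Qed.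

Lemma hcvgP (w : nat -> H) l : hcvg dot w l <-> w n @[n --> \oo] --> l.
Proof.
rewrite /hcvg; under eq_fun do rewrite hnormE.
split=> [|wl]; first by move/norm_cvg0P/subr_cvg0.
by apply/(norm_cvg0P (fun n => w n - l))/subr_cvg0.
Qed.

Lemma hilbertH : hilbert dot.
Proof.
move=> w w_cauchy.
suff : cvgn w by move=> /cvg_ex[l wl]; exists l; exact/hcvgP.
apply/cauchy_cvgP/cauchy_exP => e e0.
have e2 : 0 < e / 2 by rewrite divr_gt0.
have [N wN] := w_cauchy _ e2.
exists (w N), N => // n /= Nn; rewrite -ball_normE /=.
by rewrite -hnormE (le_lt_trans (wN N n _ _))// ltr_pdivrMr// ltr_pMr// ltr1n.
Qed.

(** Adding the pair (x, u) to the graph keeps M monotone. *)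
Lemma maximally_monotone_related M x u :
  maximally_monotone dot M -> monotonically_related dot M x u -> M x u.
Proof.
move=> [M_mono M_max] xu.
pose N y v := M y v \/ (y = x /\ v = u).
have <- : (fun y => [set v | N y v]) = M.
  apply: M_max => [|y v Myv]; last by left.
  move=> y y' v v' [Myv|[-> ->]] [Myv'|[-> ->]].
  - exact: M_mono.
  - by rewrite -(opprB x y) -(opprB u v) dotNl dotNr opprK; exact: xu.
  - exact: xu.
  - by rewrite subrr dot0l.
by right.
Qed.

Variables (M : H -> set H) (c : R).
Hypothesis M_maxmon : maximally_monotone dot M.
Hypothesis c_gt0 : 0 < c.
Local Notation J := (resolvent (op_scale c M)).

(** The scaled operator inherits from M both monotonicity and maximality, so
    Minty's theorem provides a point for the choice made by [resolvent]. *)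
Lemma resolvent_mem s : op_scale c M (J s) (s - J s).
Proof.
have [x Mx] : exists x, op_scale c M x (s - x).
  apply: (minty hilbertH) => [x _ [u Mxu <-] y _ [v Myv <-]|x u xu].
    by rewrite -scalerBr dotZr mulr_ge0 ?(ltW c_gt0)//; exact: M_maxmon.1.
  exists (c^-1 *: u); last by rewrite scalerA divff ?gt_eqF// scale1r.
  apply: (maximally_monotone_related M_maxmon) => y v Myv.
  rewrite -[v](scalerK (lt0r_neq0 c_gt0)) -scalerBr dotZr.
  by rewrite mulr_ge0 ?invr_ge0 ?(ltW c_gt0)//; apply: xu; exists v.
have [u Mu uE] : op_inv (op_add_fun (op_scale c M) id) s (J s).
  by apply: getPex; exists x, (s - x); rewrite // subrK.
by rewrite (_ : s - J s = u)//; apply/eqP; rewrite subr_eq; apply/eqP; exact: esym uE.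
Qed.

Lemma op_scale_monotone x u y v : op_scale c M x u -> op_scale c M y v ->
  0 <= dot (x - y) (u - v).
Proof.
move=> [u' Mxu <-] [v' Myv <-].
by rewrite -scalerBr dotZr mulr_ge0 ?(ltW c_gt0)//; exact: M_maxmon.1.
Qed.

Lemma resolvent_unique s x : op_scale c M x (s - x) -> J s = x.
Proof.
move=> Mx; apply/eqP; rewrite -subr_eq0; apply/eqP/(@dot_le0 _ _ dot).
have := op_scale_monotone (resolvent_mem s) Mx.
have -> : s - J s - (s - x) = - (J s - x) by rewrite !opprB addrC subrKA.
by rewrite dotNr oppr_ge0.
Qed.

Lemma resolvent_firm s t :
  0 <= dot (J s - J t) (s - t - (J s - J t)).
Proof.
have := op_scale_monotone (resolvent_mem s) (resolvent_mem t).
by rewrite subrACA.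
Qed.

Lemma resolvent_nonexp s t : `|J s - J t| <= `|s - t|.
Proof.
have := resolvent_firm s t; move: (J s - J t) (s - t) => x y.
rewrite dotDr dotNr subr_ge0 -hnorm_sqr !hnormE => h.
have [->|x0] := eqVneq x 0; first by rewrite normr0.
have x_gt0 : 0 < `|x| by rewrite normr_gt0.
have := le_trans h (dot_hnorm_le dot x y).
by rewrite !hnormE expr2 ler_pM2l.
Qed.

End Resolvent.

(** * Real series from extended-real sums *)

Lemma nneseries_cvg (R : realType) (u : nat -> R) : (forall n, 0 <= u n) ->
  (\sum_(0 <= n <oo) (u n)%:E < +oo)%E -> cvgn (series u).
Proof.
move=> u0 uoo; apply: nondecreasing_is_cvgn.
  by apply: nondecreasing_series => n _ _; exact: u0.
exists (fine (\sum_(0 <= n <oo) (u n)%:E)%E) => _ [n _ <-].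
rewrite -lee_fin fineK.
  rewrite /series/= -sumEFin; apply: nneseries_lim_ge => k _ _.
  by rewrite lee_fin.
by rewrite ge0_fin_numE// nneseries_ge0// => k _ _; rewrite lee_fin.
Qed.

Lemma eseries_pinfty_ncvg (R : realType) (u : nat -> R) :
  (\sum_(0 <= n <oo) (u n)%:E = +oo)%E -> ~ cvgn (series u).
Proof.
move=> uoo u_cvg; have : (\sum_(0 <= n <oo) (u n)%:E = (limn (series u))%:E)%E.
  rewrite -EFin_lim//; congr (limn _).
  by apply/funext => n; rewrite /series/= sumEFin.
by rewrite uoo.
Qed.

(** * The splitting operator on the product space *)

Section SplittingOperator.
Context {R : realType} {H : completeNormedModType R} (dot : {dot H for idfun}).
Hypothesis normE : forall x : H, `|x| = Num.sqrt (dot x x).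
Context {m : nat} (A : 'I_m -> H -> set H) (B : H -> H).
Context (omega : 'I_m -> R) (beta gamma alpha : R).
Hypothesis A_maxmon : forall i, maximally_monotone dot (A i).
Hypothesis B_coco : cocoercive dot beta B.
Hypothesis omega_gt0 : forall i, 0 < omega i.
Hypothesis omega_sum : \sum_(i < m) omega i = 1.
Hypothesis beta_gt0 : 0 < beta.
Hypothesis gamma_gt0 : 0 < gamma.
Hypothesis alpha_gt0 : 0 < alpha.
Hypothesis alphaP : 2 * beta <= alpha * (4 * beta - gamma).

Local Notation Hm := ('I_m -> H).
Local Notation wd := (wdot dot omega_gt0 : {dot Hm for idfun}).

Definition barycenter (z : Hm) : H := \sum_(i < m) omega i *: z i.
Local Notation P := barycenter.

Definition splitting_arg (z : Hm) (i : 'I_m) : H :=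
  2 *: P z - z i - gamma *: B (P z).

Definition splitting_res (z : Hm) : Hm := fun i =>
  resolvent (op_scale (gamma / omega i) (A i)) (splitting_arg z i).
Local Notation Q := splitting_res.

(** The unrelaxed step Q z - P z is extrapolated by 1 / alpha, which keeps the
    map nonexpansive; the algorithm is then a Krasnoselskii-Mann iteration with
    relaxation parameters alpha * lambda. *)
Definition splitting_op (z : Hm) : Hm :=
  z + alpha^-1 *: (Q z - cst (P z)).

Lemma splitting_resE z : Q z - cst (P z) = alpha *: (splitting_op z - z).
Proof.
rewrite /splitting_op addrAC subrr add0r scalerA divff ?gt_eqF//.
by rewrite scale1r.
Qed.

Lemma barycenterB z z' : P (z - z') = P z - P z'.
Proof. by rewrite /P -sumrB; apply: eq_bigr => i _; exact: scalerBr. Qed.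

Lemma wdot_cst z h : wd z (cst h) = dot (P z) h.
Proof.
rewrite /P (big_morph (dot ^~ h) (fun x y => dotDl dot x y h) (dot0l dot h)).
by apply: eq_bigr => i _; rewrite dotZl.
Qed.

Lemma barycenter_cst h : P (cst h) = h.
Proof. by rewrite /P -scaler_suml omega_sum scale1r. Qed.

Lemma wdot_cst2 g h : wd (cst g) (cst h) = dot g h.
Proof. by rewrite wdot_cst barycenter_cst. Qed.

Lemma norm_barycenter_le z : `|P z| <= hnorm wd z.
Proof.
have : `|P z| ^+ 2 <= hnorm wd z * `|P z|.
  rewrite -{1}(hnormE normE) hnorm_sqr -wdot_cst.
  apply: le_trans (dot_hnorm_le _ _ _) _.
  by rewrite ler_wpM2l ?hnorm_ge0// /hnorm wdot_cst2 normE.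
have [->|x0] := eqVneq (P z) 0; first by rewrite normr0 hnorm_ge0.
by rewrite expr2 ler_pM2r// normr_gt0.
Qed.

Lemma scale_gt0 i : 0 < gamma / omega i.
Proof. by rewrite divr_gt0. Qed.

Section Pair.
Variables z z' : Hm.
Let d := z - z'.
Let X : Hm := cst (P z - P z').
Let q := Q z - Q z'.
Let b : Hm := cst (B (P z) - B (P z')).

Let XX : wd X X = wd d X.
Proof. by rewrite wdot_cst2 wdot_cst barycenterB. Qed.

Let Xb : wd X b = wd d b.
Proof. by rewrite wdot_cst2 wdot_cst barycenterB. Qed.

Let coco : beta * wd b b <= wd d b.
Proof.
rewrite wdot_cst2 wdot_cst barycenterB -(hnorm_sqr dot) (hnormE normE).
exact: B_coco.
Qed.

Let firm : 0 <= wd q (2 *: X - d - gamma *: b - q).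
Proof.
apply: sumr_ge0 => i _; rewrite mulr_ge0 ?(ltW (omega_gt0 i))//.
have := resolvent_firm normE (A_maxmon i) (scale_gt0 i)
  (splitting_arg z i) (splitting_arg z' i).
congr (0 <= dot _ (_ - _)); rewrite /splitting_arg subrACA.
by rewrite [X in X - _ = _]subrACA -!scalerBr.
Qed.

Lemma splitting_nonexp :
  hnorm wd (splitting_op z - splitting_op z') <= hnorm wd (z - z').
Proof.
have := three_operator_averaged (ltW gamma_gt0) XX Xb coco firm
  alpha_gt0 beta_gt0 alphaP.
congr (hnorm wd _ <= _).
rewrite /splitting_op [in RHS]opprD [RHS]addrACA -[in RHS]scalerBr.
by congr (_ + _ *: _); rewrite [RHS]subrACA.
Qed.

(** A quantitative form of nonexpansiveness that also controls the values of B;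
    it yields their strong convergence. *)
Lemma splitting_coco_le :
  wd (d + (q - X)) (d + (q - X)) +
    gamma * (2 * beta - gamma) * `|B (P z) - B (P z')| ^+ 2 <= wd d d.
Proof.
have := three_operator_estimate (ltW gamma_gt0) XX Xb coco firm.
rewrite [wd b b]wdot_cst2 -(hnorm_sqr dot) (hnormE normE) => h.
apply: le_trans h; rewrite lerD2r lerDl; exact: dot_ge0.
Qed.

End Pair.

(** If u_i in A_i x sum to - B x, then z_i = x - gamma B x - gamma u_i / omega_i
    has barycenter x, and J_(gamma A_i / omega_i) maps
    2 x - z_i - gamma B x = x + gamma u_i / omega_i to x. *)
Lemma zero_splitting_fix x : op_add_fun (op_sum A) B x 0 ->
  exists z, splitting_op z = z.
Proof.
move=> [_ [u Au <-] uB].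
pose z : Hm := fun i => x - gamma *: B x - (gamma / omega i) *: u i.
have Pz : P z = x.
  rewrite /P /z; under eq_bigr => i _.
    rewrite scalerBr scalerA mulrCA divff ?gt_eqF// mulr1.
    over.
  rewrite sumrB -scaler_suml omega_sum scale1r -scaler_sumr.
  by rewrite -addrA -opprD -scalerDr [B x + _]addrC uB scaler0 subr0.
exists z; rewrite /splitting_op (_ : Q z = cst (P z)).
  by rewrite subrr scaler0 addr0.
apply/funext => i; rewrite /Q Pz.
apply: (resolvent_unique normE (A_maxmon i) (scale_gt0 i)).
exists (u i); first exact: Au.
rewrite /splitting_arg Pz /z !opprB scaler_nat mulr2n.
move: (gamma *: B x) (_ *: u i) => g c.
have -> : x + x + (c + (g - x)) = x + c + g.
  by rewrite [c + _]addrA [LHS]addrA addrAC addrK addrA.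
by rewrite addrK addrAC subrr add0r.
Qed.

(** At a fixed point all the resolvents take the value P z; summing the
    inclusions they satisfy with the weights omega_i cancels the z_i. *)
Lemma splitting_fix_zero z : splitting_op z = z -> op_add_fun (op_sum A) B (P z) 0.
Proof.
move=> zfix.
have QP : Q z = cst (P z).
  by apply/eqP; rewrite -subr_eq0 splitting_resE zfix subrr scaler0.
have /choice[u uP] : forall i, exists u, A i (P z) u /\
    gamma *: u = omega i *: (P z - z i - gamma *: B (P z)).
  move=> i; have := resolvent_mem normE (A_maxmon i) (scale_gt0 i)
    (splitting_arg z i).
  rewrite -/(Q z i) QP /= => -[u Au uE]; exists u; split => //.
  have := congr1 (fun v => omega i *: v) uE.
  rewrite scalerA mulrCA divff ?gt_eqF// mulr1 => ->; congr (_ *: _).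
  rewrite /splitting_arg scaler_nat mulr2n.
  by rewrite addrAC [P z + P z - _ - _]addrAC addrK.
exists (\sum_i u i); first by exists u => // i; have [] := uP i.
apply: (scalerI (lt0r_neq0 gamma_gt0)).
rewrite scaler0 scalerDr scaler_sumr.
rewrite (eq_bigr (fun i => omega i *: (P z - gamma *: B (P z)) - omega i *: z i)).
  rewrite sumrB -scaler_suml omega_sum scale1r -/(P z).
  by rewrite addrAC subrK subrr.
move=> i _; have [_ ->] := uP i.
by rewrite -scalerBr addrAC.
Qed.

End SplittingOperator.

(** * Convergence of the algorithm *)

(** The number 2 beta / (4 beta - gamma) is the averagedness constant given by
    the three-operator estimate. It is at most 2 / 3 when gamma <= beta, and at
    most 2 gamma / (gamma + 2 beta) when beta <= gamma < 2 beta, because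
    (gamma - beta) (2 beta - gamma) >= 0. *)
Lemma averagedness_constant (R : realFieldType) (alpha beta gamma : R) :
  0 < gamma < 2 * beta -> 2 / 3 <= alpha ->
  2 * gamma <= alpha * (gamma + 2 * beta) ->
  2 * beta <= alpha * (4 * beta - gamma).
Proof.
move=> /andP[g0 gb] a1 a2; have [gb1|gb1] := leP gamma beta.
  have : 0 <= (alpha - 2 / 3) * (4 * beta - gamma).
    by apply: mulr_ge0; lra.
  lra.
rewrite -(@ler_pM2l _ (gamma + 2 * beta)); last by lra.
have h1 : 0 <= (alpha * (gamma + 2 * beta) - 2 * gamma) * (4 * beta - gamma).
  by apply: mulr_ge0; lra.
have h2 : 0 <= (gamma - beta) * (2 * beta - gamma) by apply: mulr_ge0; lra.
lra.
Qed.

Theorem proposition6p3 (R : realType) (H : completeNormedModType R)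
  (dot : {dot H for idfun}) (normE : forall x : H, `|x| = Num.sqrt (dot x x))
  (m : nat) (A : 'I_m -> H -> set H)
  (A_maxmon : forall i, maximally_monotone dot (A i))
  (beta : R) (beta_gt0 : 0 < beta)
  (B : H -> H) (B_coco : cocoercive dot beta B)
  (zeros_exist : exists x : H, op_add_fun (op_sum A) B x 0)
  (omega : 'I_m -> R) (omega_01 : forall i, 0 < omega i < 1)
  (omega_sum : \sum_(i < m) omega i = 1)
  (gamma : R) (gamma_bnd : 0 < gamma < 2 * beta)
  (alpha : R)
  (alphaE : alpha = Num.max (2 / 3) (2 * gamma / (gamma + 2 * beta)))
  (lambda : nat -> R) (lambda_bnd : forall n, 0 < lambda n < 1 / alpha)
  (a : nat -> H) (b : 'I_m -> nat -> H)
  (lambda_sum :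
    (\sum_(0 <= n <oo) (lambda n * (1 - alpha * lambda n))%:E = +oo)%E)
  (error_sum :
    (\big[maxe/-oo]_(i < m)
       \sum_(0 <= n <oo) (lambda n * (`|a n| + `|b i n|))%:E < +oo)%E)
  (x : nat -> H) (s p z : 'I_m -> nat -> H)
  (xE : forall n, x n = \sum_(i < m) omega i *: z i n)
  (sE : forall i n,
    s i n = 2 *: x n - z i n - gamma *: (B (x n) + a n))
  (pE : forall i n,
    p i n = resolvent (op_scale (gamma / omega i) (A i)) (s i n) + b i n)
  (zE : forall i n,
    z i n.+1 = z i n + lambda n *: (p i n - x n)) :
  exists xbar : H,
    [/\ op_add_fun (op_sum A) B xbar 0,
        weakly_cvg dot x xbar,
        B (x n) @[n --> \oo] --> B xbar &
        x n.+1 - x n @[n --> \oo] --> (0 : H)].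
Proof.
have omega_gt0 i : 0 < omega i by have /andP[] := omega_01 i.
have /andP[gamma_gt0 gamma_lt] := gamma_bnd.
have alpha_ge1 : 2 / 3 <= alpha by rewrite alphaE le_max lexx.
have alpha_ge2 : 2 * gamma <= alpha * (gamma + 2 * beta).
  rewrite -ler_pdivrMr; last by rewrite addr_gt0// mulr_gt0.
  by rewrite alphaE le_max lexx orbT.
have alpha_gt0 : 0 < alpha by lra.
have alphaP : 2 * beta <= alpha * (4 * beta - gamma).
  exact: averagedness_constant.
pose wd : {dot ('I_m -> H) for idfun} := wdot dot omega_gt0.
pose T := splitting_op A B omega gamma alpha.
pose w n i := z i n.
have xP n : x n = barycenter omega (w n) by exact: xE.
pose mu n := alpha * lambda n.
pose err n : 'I_m -> H := fun i =>
  lambda n *: (p i n - splitting_res A B omega gamma (w n) i).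
have wE n : w n.+1 = w n + mu n *: (T (w n) - w n) + err n.
  have -> : T (w n) - w n =
      alpha^-1 *: (splitting_res A B omega gamma (w n) - cst (x n)).
    by rewrite /T /splitting_op xP addrAC subrr add0r.
  rewrite scalerA /mu mulrAC divff ?gt_eqF// mul1r.
  apply/funext => i; rewrite !fctE /w zE -addrA; congr (_ + _).
  by rewrite /err -scalerDr; congr (_ *: _); rewrite [RHS]addrC subrKA.
have errB i n : `|p i n - splitting_res A B omega gamma (w n) i| <=
    gamma * `|a n| + `|b i n|.
  rewrite pE addrAC (le_trans (ler_normD _ _))// lerD2r.
  apply: le_trans (resolvent_nonexp normE (A_maxmon i) (scale_gt0 _ gamma_gt0 i) _ _) _
    => //.
  rewrite sE /splitting_arg -xP scalerDr subrACA subrr sub0r addrAC subrr add0r.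
  by rewrite normrN normrZ gtr0_norm.
have lambda_gt0 n : 0 < lambda n by have /andP[] := lambda_bnd n.
have err_norm n : hnorm wd (err n) <=
    \sum_(i < m) (1 + gamma) * (lambda n * (`|a n| + `|b i n|)).
  apply: (le_trans (hnorm_wdot_le _ _ _)); apply: ler_sum => i _.
  rewrite (hnormE normE) normrZ gtr0_norm// mulrCA [leRHS]mulrCA.
  apply: (ler_wpM2l (ltW (lambda_gt0 n))).
  apply: (@le_trans _ _ (1 * (gamma * `|a n| + `|b i n|))).
    apply: ler_pM => //.
    rewrite -sqrtr1 ler_wsqrtr//; have /andP[_ /ltW//] := omega_01 i.
  have := normr_ge0 (a n); have := mulr_ge0 (ltW gamma_gt0) (normr_ge0 (b i n)).
  lra.
have err_sum : cvgn (series (fun n => hnorm wd (err n))).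
  apply: (series_le_cvg _ _ err_norm) => [n|n|].
  - exact: hnorm_ge0.
  - apply: sumr_ge0 => i _; apply: mulr_ge0.
      by rewrite addr_ge0// ltW.
    by rewrite mulr_ge0 ?addr_ge0// ltW.
  have tC i : cvgn (series (fun n => lambda n * (`|a n| + `|b i n|))).
    apply: nneseries_cvg => [n|].
      by rewrite mulr_ge0 ?addr_ge0// ltW.
    by apply: le_lt_trans error_sum; exact: le_bigmax.
  rewrite (_ : series _ = fun n =>
      \sum_(i < m) series ((1 + gamma) *: (fun k => lambda k * (`|a k| + `|b i k|))) n).
    apply/cvg_ex; exists (\sum_(i < m) limn (series ((1 + gamma) *:
      (fun k => lambda k * (`|a k| + `|b i k|))))).
    apply: cvg_big => [|i _]; first exact: add_continuous.
    exact: is_cvg_seriesZ.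
  by apply/funext => n; rewrite /series/= exchange_big.
have mu_01 n : 0 <= mu n <= 1.
  have /andP[l0 l1] := lambda_bnd n.
  rewrite ltr_pdivlMr// mulrC in l1.
  by rewrite /mu !ltW// mulr_gt0.
have mu_sum : ~ cvgn (series (fun n => mu n * (1 - mu n))).
  move=> mu_cvg; apply: (eseries_pinfty_ncvg lambda_sum).
  rewrite (_ : (fun n => _) = alpha^-1 *: (fun n => mu n * (1 - mu n))).
    exact: is_cvg_seriesZ.
  apply/funext => n; rewrite [RHS](_ : _ = alpha^-1 * (mu n * (1 - mu n)))//.
  by rewrite /mu !mulrA mulVf ?gt_eqF// mul1r.
have Tnonexp u v : hnorm wd (T u - T v) <= hnorm wd (u - v).
  exact: (splitting_nonexp normE A_maxmon B_coco omega_gt0 omega_sum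
    beta_gt0 gamma_gt0 alpha_gt0 alphaP).
have Tfix : exists f, T f = f.
  have [x0 x0P] := zeros_exist.
  exact: (zero_splitting_fix normE alpha A_maxmon omega_gt0 omega_sum
    gamma_gt0 x0P).
have wd_hilbert : hilbert wd by exact/hilbert_wdot/(hilbertH normE).
have [c Tc cP] := KM_weak_cvg wd_hilbert Tnonexp mu_01 mu_sum err_sum wE Tfix.
have res0 := KM_residual_cvg0 Tnonexp mu_01 mu_sum err_sum wE Tfix.
have [K wK] := KM_bounded Tnonexp mu_01 err_sum wE Tc.
exists (barycenter omega c); split.
- exact: (splitting_fix_zero normE A_maxmon omega_gt0 omega_sum gamma_gt0
    alpha_gt0 Tc).
- move=> u; rewrite -(wdot_cst dot omega_gt0).
  under eq_fun do rewrite xP -(wdot_cst dot omega_gt0).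
  exact: cP.
- pose k := gamma * (2 * beta - gamma).
  (* the three-operator estimate at z_n and c, where D = alpha (T z_n - z_n) *)
  have k_gt0 : 0 < k by rewrite mulr_gt0// subr_gt0.
  pose C := k^-1 * (2 * (K * alpha)).
  have BxC n : `|B (x n) - B (barycenter omega c)| <=
      Num.sqrt (C * hnorm wd (T (w n) - w n)).
    rewrite -[leLHS]normr_id -[leLHS]sqrtr_sqr; apply: ler_wsqrtr.
    rewrite /C -mulrA ler_pdivlMl// xP.
    have := splitting_coco_le normE A_maxmon B_coco omega_gt0 omega_sum gamma_gt0
      (w n) c.
    rewrite subrACA !(splitting_resE _ _ _ _ alpha_gt0) -/T Tc subrr scaler0 subr0.
    rewrite -/wd -/k; set D := alpha *: _; set d := w n - c.
    have := dot_hnorm_le wd d (- D); rewrite hnormN hnormZ gtr0_norm//.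
    have : hnorm wd d * (alpha * hnorm wd (T (w n) - w n)) <=
        K * (alpha * hnorm wd (T (w n) - w n)).
      by rewrite ler_wpM2r ?wK// mulr_ge0 ?hnorm_ge0// ltW.
    have := dot_ge0 wd D; clearbody D d wd; rewrite !dotE (dotC wd D d); lra.
  apply: (iffLR (subr_cvg0 _ _)); apply: (normr_le_cvg0 BxC).
  rewrite (_ : nbhs 0 = nbhs (Num.sqrt (C * 0) : R)); last by rewrite mulr0 sqrtr0.
  apply: continuous_cvg; first exact: sqrt_continuous.
  by apply: cvgM => //; exact: cvg_cst.
- apply/norm_cvg0P.
  apply: (@normr_le_cvg0 _ _ _ _
    (fun n => hnorm wd (T (w n) - w n) + hnorm wd (err n))).
    move=> n; rewrite normr_id !xP -barycenterB.
    apply: le_trans (norm_barycenter_le normE omega_gt0 omega_sum _) _.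
    rewrite wE -(addrA (w n)) addrAC subrr add0r.
    apply: le_trans (hnormD _ _ _) _; rewrite lerD2r hnormZ.
    have /andP[mu0 mu1] := mu_01 n.
    by rewrite ger0_norm// ler_piMl// hnorm_ge0.
  rewrite (_ : nbhs 0 = nbhs (0 + 0 : R)); last by rewrite addr0.
  by apply: cvgD => //; exact: cvg_series_cvg_0.
Qed.
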